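(* Let $f:\mathbb{R}^n\to\mathbb{R}$ be a $C^2$-smooth function whose critical set has measure zero and such that $\lim_{p\to\infty}f(p)=+\infty$. Let $\varphi,\psi:\mathbb{R}\to\mathbb{R}$ be $C^2$-smooth convex unbounded functions such that $\varphi'>0$ and $\psi'>0$ on $\mathbb{R}$. If $\mathbb{R}^n\setminus\mathrm{Hess}^+(f)$ is bounded, then $\mathbb{R}^n\setminus\mathrm{Hess}^+\big((\varphi\circ f)(\psi\circ f)\big)$ is bounded as well.
   Context: For a $C^2$-smooth function $F:\mathbb{R}^n\to\mathbb{R}$, $H_x(F)$ denotes the Hessian matrix of $F$ at $x$, and $\mathrm{Hess}^+(F)=\{x\in\mathbb{R}^n : H_x(F)\text{ is positive definite}\}$. The critical set of $f$ is $\{x\in\mathbb{R}^n:\nabla f(x)=0\}$; measure is Lebesgue measure; $p\to\infty$ means $\|p\|\to\infty$. $(\varphi\circ f)(\psi\circ f)$ is the pointwise product of $\varphi\circ f$ and $\psi\circ f$. *)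

(* Defs.v *)
From HB Require Import structures.
From mathcomp Require Import all_boot all_order all_algebra.
From mathcomp Require Import all_classical all_reals all_analysis.

Set Implicit Arguments.
Unset Strict Implicit.
Unset Printing Implicit Defensive.

Import Order.TTheory GRing.Theory Num.Theory.
Import numFieldNormedType.Exports.

Local Open Scope classical_set_scope.
Local Open Scope ring_scope.

Section differential_calculus.
Variables (R : realType) (n : nat).
Implicit Types (F : 'rV[R]_n -> R) (i j : 'I_n) (x : 'rV[R]_n).

Definition pderiv i F : 'rV[R]_n -> R := fun x => 'D_(delta_mx 0 i) F x.

Definition pderivable i F : Prop := forall x, derivable F x (delta_mx 0 i).

Definition C2 F : Prop :=
  [/\ continuous F,
      forall i, pderivable i F /\ continuous (pderiv i F) &
      forall i j, pderivable i (pderiv j F) /\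
                  continuous (pderiv i (pderiv j F))].

Definition gradient F x : 'rV[R]_n := \row_i pderiv i F x.

Definition critical_set F : set 'rV[R]_n := [set x | gradient F x = 0].

Definition hessian F x : 'M[R]_n := \matrix_(i, j) pderiv i (pderiv j F) x.

Definition posdefmx (A : 'M[R]_n) : Prop :=
  A^T = A /\ forall v : 'rV[R]_n, v != 0 -> 0 < (v *m A *m v^T) 0 0.

Definition Hess_pos F : set 'rV[R]_n := [set x | posdefmx (hessian F x)].

End differential_calculus.

Definition C2_real (R : realType) (g : R -> R) : Prop :=
  [/\ forall t, derivable g t 1,
      forall t, derivable (derive1 g) t 1 &
      continuous (derive1 (derive1 g))].

Section norm_at_infinity.
Variables (R : realType) (n : nat).

(* The library norm on ['rV[R]_n] is the sup norm; being equivalent to the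
   Euclidean one, it has the same neighborhoods of infinity and the same
   bounded sets. *)
Definition norm_infty : set_system 'rV[R]_n :=
  filter_from [set: R] (fun M => [set p | M < `|p|]).

End norm_at_infinity.

(* Lebesgue's outer measure on R^n: infimum, over the countable covers by closed
   boxes, of the total volume. On Lebesgue measurable sets it is Lebesgue
   measure, and the sets at which it vanishes are the Lebesgue null sets. *)
Section lebesgue_outer_measure.
Variables (R : realType) (n : nat).
Implicit Types (B : 'rV[R]_n * 'rV[R]_n) (A : set 'rV[R]_n).

Definition box B : set 'rV[R]_n :=
  [set x | forall i, B.1 0 i <= x 0 i <= B.2 0 i].

Definition box_volume B : R := \prod_(i < n) Num.max 0 (B.2 0 i - B.1 0 i).

(* Indexing by countable sets of boxes, not by sequences, allows the empty
   cover, which matters when n = 0 since every box then has volume 1. *)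
Definition lebesgue_outer A : \bar R :=
  ereal_inf [set \esum_(B in C) (box_volume B)%:E |
    C in [set C | countable C /\ A `<=` \bigcup_(B in C) box B]].

Definition measure_zero A : Prop := lebesgue_outer A = 0%E.

End lebesgue_outer_measure.

(* Main.v *)
(* The product is h o f with h = phi psi, and its Hessian at x is
   h'(f x) H_x(f) + h''(f x) (grad f(x))^T (grad f(x)).
   A convex function lies above its tangent lines, so phi and psi, having
   positive slope, are positive near +oo; together with phi'', psi'' >= 0 this
   gives h' > 0 and h'' >= 0 near +oo.  As f tends to +oo at infinity, outside
   some ball H_x(f) is positive definite and f x is large, so the Hessian is a
   positive multiple of H_x(f) plus a positive semidefinite matrix. *)
Require Import Defs.
From HB Require Import structures.
From mathcomp Require Import all_boot all_order all_algebra.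
From mathcomp Require Import all_classical all_reals all_analysis.
From mathcomp Require Import ring lra.
Import Order.TTheory GRing.Theory Num.Theory.
Import numFieldNormedType.Exports.
Local Open Scope classical_set_scope.
Local Open Scope ring_scope.

Set Implicit Arguments.
Unset Strict Implicit.

(** [C2] speaks of partial derivatives only, so the chain rule is needed along a single direction
    [v]. Restricting to the line [t *: v + x] reduces it to the one-variable chain rule at
    [t = 0]. *)
Lemma is_derive_comp_real (R : realType) (V : normedModType R)
    (f : V -> R) (h : R -> R) (x v : V) (df dh : R) :
  is_derive x v f df -> is_derive (f x) 1 h dh ->
  is_derive x v (h \o f) (dh * df).
Proof.
move=> [fx fE] hx.
have lineE (k : V -> R) : 'D_v k x = 'D_1 (fun t : R => k (t *: v + x)) 0.
  rewrite /derive; set q := fun t => t^-1 *: _; set q' := fun t => t^-1 *: _.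
  suff -> : q = q' by []; apply/funext => t; rewrite /q /q' /=.
  by rewrite addr0 scale0r add0r [t%:A]mulr1.
have line_der : is_derive (0 : R) 1 (fun t : R => f (t *: v + x)) df.
  by apply: DeriveDef; [exact: (derivable1P f x v).1 | rewrite -lineE].
have h0 : is_derive (f ((0 : R) *: v + x)) 1 h dh by rewrite scale0r add0r.
have [cx cE] := @is_derive1_comp _ _ _ _ _ _ h0 line_der.
by apply: DeriveDef; [exact: (derivable1P (h \o f) x v).2 | rewrite lineE].
Qed.

(** By convexity, the difference quotient of [g] at [x] along [y - x] is at most [g y - g x] for
    [0 < t <= 1]; let [t] tend to 0 from the right. *)
Lemma convex_tangent_le (R : realType) (g : R -> R) :
  convex_function [set: R] g -> (forall t, derivable g t 1) ->
  forall x y, g x + derive1 g x * (y - x) <= g y.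
Proof.
move=> cg dg x y.
have gx : is_derive x 1 g (derive1 g x) by rewrite derive1E; exact/derivableP.
(* Deriving along the vector [y - x] treats both signs of [y - x] at once. *)
have [dx dE] := @is_derive_comp_real R R^o id g x (y - x) _ _
  (is_derive_id _ _) gx.
have quot_cvg := cvg_dnbhs_at_right dx.
rewrite -lerBrDl -dE /derive -(cvg_lim _ quot_cvg)//.
apply: limr_le; first exact: cvgP quot_cvg.
near=> t => /=.
have t0 : 0 < t by near: t; exact: nbhs_right_gt.
have t1 : t <= 1 by near: t; exact: nbhs_right_le.
have i01t : Itv.spec (@Itv.num_sem R) (Itv.Real `[0%Z, 1%Z]) t.
  by apply/andP; split; [rewrite num_real | rewrite /= in_itv/= ltW].
have conv_le : g (t * y + (1 - t) * x) <= t * g y + (1 - t) * g x.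
  exact: (cg (Itv.mk i01t) y x (mem_set I) (mem_set I)).
rewrite (_ : t *: (y - x) + x = t * y + (1 - t) * x); last first.
  by rewrite /GRing.scale/=; ring.
rewrite /GRing.scale/= ler_pdivrMl//; lra.
Unshelve. all: by end_near. Qed.

Lemma nondecreasing_derive1_ge0 (R : realType) (g : R -> R) (x : R) :
  {homo g : s t / s <= t} -> derivable g x 1 -> 0 <= derive1 g x.
Proof.
move=> ndg dg; rewrite derive1E; apply: limr_ge => //.
near=> t => /=.
rewrite [t%:A]mulr1.
have [t0|t0] := leP 0 t.
  by rewrite mulr_ge0 ?invr_ge0// subr_ge0 ndg// lerDr.
by rewrite mulr_le0 ?invr_le0 ?subr_le0 ?ndg ?gerDr// ltW.
Unshelve. all: by end_near. Qed.

(** Adding the tangent inequalities at [s] and at [t] gives [(g' t - g' s) (t - s) >= 0], so [g'] is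
    nondecreasing. *)
Lemma convex_derive2_ge0 (R : realType) (g : R -> R) x :
  convex_function [set: R] g -> (forall t, derivable g t 1) ->
  derivable (derive1 g) x 1 -> 0 <= derive1 (derive1 g) x.
Proof.
move=> cg dg ddg; apply: nondecreasing_derive1_ge0 ddg => s t.
have tangent := convex_tangent_le cg dg.
rewrite le_eqVlt => /predU1P[->//|st].
have st0 : 0 < t - s by rewrite subr_gt0.
rewrite -(ler_pM2r st0).
have := tangent s t; have := tangent t s; lra.
Qed.

Lemma Hess_pos_comp (R : realType) (n : nat) (f : 'rV[R]_n -> R)
    (h : R -> R) (x : 'rV[R]_n) :
  C2 f -> (forall t, derivable h t 1) -> derivable (derive1 h) (f x) 1 ->
  0 < derive1 h (f x) -> 0 <= derive1 (derive1 h) (f x) -> Hess_pos f x ->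
  Hess_pos (h \o f) x.
Proof.
move=> [_ f1 f2] dh ddh h1 h2 [Hsym Hpos].
(* An equality of functions, since it is differentiated once more. *)
have gradE j : pderiv j (h \o f) = (derive1 h \o f) * pderiv j f.
  apply/funext => y; rewrite /pderiv.
  have dhy : is_derive (f y) 1 h (derive1 h (f y)).
    by rewrite derive1E; exact/derivableP/dh.
  by have [_ ->] := is_derive_comp_real (derivableP ((f1 j).1 y)) dhy.
have hessE : hessian (h \o f) x = derive1 h (f x) *: hessian f x +
    derive1 (derive1 h) (f x) *: ((gradient f x)^T *m gradient f x).
  apply/matrixP => i j; rewrite !mxE big_ord1 !mxE gradE {1}/pderiv.
  have dfi : is_derive x (delta_mx 0 i) f (pderiv i f x).
    exact/derivableP/(f1 i).1.
  have dh1 : is_derive (f x) 1 (derive1 h) (derive1 (derive1 h) (f x)).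
    by rewrite (derive1E (derive1 h)); exact/derivableP.
  have dfij : is_derive x (delta_mx 0 i) (pderiv j f) (pderiv i (pderiv j f) x).
    exact/derivableP/(f2 i j).1.
  have [_ ->] := is_deriveM (is_derive_comp_real dfi dh1) dfij.
  by rewrite /GRing.scale/=; ring.
split.
  by rewrite /= hessE linearD !linearZ/= Hsym trmx_mul trmxK.
move=> v v0; rewrite hessE mulmxDr mulmxDl -!scalemxAr -!scalemxAl.
have entryE a b (A B : 'M[R]_1) : (a *: A + b *: B) 0 0 = a * A 0 0 + b * B 0 0.
  by rewrite !mxE.
rewrite entryE ltr_pwDl// ?mulr_gt0 ?Hpos// mulr_ge0//.
(* The rank-one term contributes the square of the scalar product of the gradient with [v]. *)
have -> : v *m ((gradient f x)^T *m gradient f x) *m v^T =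
    (gradient f x *m v^T)^T *m (gradient f x *m v^T).
  by rewrite trmx_mul trmxK !mulmxA.
by rewrite mxE big_ord1 [X in X * _]mxE -expr2 sqr_ge0.
Qed.

(** [T] is the zero of the tangent line at 0, which has positive slope and lies below [g]. *)
Lemma convex_increasing_eventually_gt0 (R : realType) (g : R -> R) :
  convex_function [set: R] g -> (forall t, derivable g t 1) ->
  0 < derive1 g 0 -> exists T, forall t, T < t -> 0 < g t.
Proof.
move=> cg dg g'0; exists (- g 0 / derive1 g 0) => t.
rewrite ltr_pdivrMr// => gt; apply: lt_le_trans (convex_tangent_le cg dg 0 t).
by lra.
Qed.

Lemma derive1M (R : realType) (g h : R -> R) (t : R) :
  derivable g t 1 -> derivable h t 1 ->
  derive1 (g * h) t = g t * derive1 h t + h t * derive1 g t.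
Proof. by move=> dg dh; rewrite !derive1E deriveM. Qed.

Theorem proposition3p5 (R : realType) (n : nat)
    (f : 'rV[R]_n -> R) (phi psi : R -> R)
    (fC2 : C2 f)
    (fcrit : measure_zero (critical_set f))
    (finfty : f x @[x --> @norm_infty R n] --> +oo)
    (phiC2 : C2_real phi) (psiC2 : C2_real psi)
    (phi_convex : convex_function [set: R] phi)
    (psi_convex : convex_function [set: R] psi)
    (phi_unbounded : ~ bounded_fun phi)
    (psi_unbounded : ~ bounded_fun psi)
    (phi'_gt0 : forall t, 0 < derive1 phi t)
    (psi'_gt0 : forall t, 0 < derive1 psi t)
    (Hf : bounded_set (~` Hess_pos f)) :
  bounded_set (~` Hess_pos ((phi \o f) \* (psi \o f))).
Proof.
have [dphi ddphi _] := phiC2; have [dpsi ddpsi _] := psiC2.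
have [Tphi phi_gt0] :=
  convex_increasing_eventually_gt0 phi_convex dphi (phi'_gt0 0).
have [Tpsi psi_gt0] :=
  convex_increasing_eventually_gt0 psi_convex dpsi (psi'_gt0 0).
have h'E : derive1 (phi * psi) = phi * derive1 psi + psi * derive1 phi.
  by apply/funext => t; exact: derive1M.
have h''E t : derive1 (derive1 (phi * psi)) t =
    phi t * derive1 (derive1 psi) t + derive1 psi t * derive1 phi t +
    (psi t * derive1 (derive1 phi) t + derive1 phi t * derive1 psi t).
  rewrite h'E derive1E deriveD.
  - rewrite -!derive1E (derive1M (dphi t) (ddpsi t)).
    by rewrite (derive1M (dpsi t) (ddphi t)).
  - exact: (derivableM (dphi t) (ddpsi t)).
  - exact: (derivableM (dpsi t) (ddphi t)).
have [Mf [_ Mf_]] := Hf.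
have [M _ f_gt] := finfty _ (nbhs_pinfty_gt (num_real (Num.max Tphi Tpsi))).
(* Beyond [M], [f] exceeds both thresholds. [Mf] bounds the complement of [Hess_pos f] only through
   radii strictly larger than [Mf], hence [Mf + 1]. *)
exists (Num.max (Mf + 1) M); split; first exact: num_real.
move=> B; rewrite gt_max => /andP[MfB MB] x /= Hx.
rewrite leNgt; apply/negP => xB; apply: Hx.
have := f_gt x (lt_trans MB xB).
rewrite /= gt_max => /andP[/phi_gt0 phi0 /psi_gt0 psi0].
have phi2 := convex_derive2_ge0 phi_convex dphi (ddphi (f x)).
have psi2 := convex_derive2_ge0 psi_convex dpsi (ddpsi (f x)).
have phi1 := phi'_gt0 (f x); have psi1 := psi'_gt0 (f x).
(* The product of the two compositions is convertible to [(phi * psi) \o f]. *)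
apply: (@Hess_pos_comp R n f (phi * psi) x fC2).
- by move=> t; exact: (derivableM (dphi t) (dpsi t)).
- rewrite h'E; apply: derivableD.
    exact: (derivableM (dphi (f x)) (ddpsi (f x))).
  exact: (derivableM (dpsi (f x)) (ddphi (f x))).
- rewrite h'E; exact: (addr_gt0 (mulr_gt0 phi0 psi1) (mulr_gt0 psi0 phi1)).
- rewrite h''E; apply: addr_ge0; apply: addr_ge0.
  + exact: (mulr_ge0 (ltW phi0) psi2).
  + exact: (ltW (mulr_gt0 psi1 phi1)).
  + exact: (mulr_ge0 (ltW psi0) phi2).
  + exact: (ltW (mulr_gt0 phi1 psi1)).
- apply: contrapT => /(Mf_ (Mf + 1) (ltr_pwDr ltr01 (lexx Mf))) /=.
  by rewrite leNgt (lt_trans MfB xB).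
Qed.
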